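(* Let $E$ be a finite set and let $\tau:2^E\to 2^E$ be a closure operator with set of closed sets $\mathcal{L}\subseteq 2^E$. Then cover-closure $\xi:\mathcal{L}\to\mathcal{L}$, $\xi(X)=\tau(\mathrm{cov}(X))$, is bijective if and only if $\mathcal{L}$ is isomorphic to the set of order ideals $J(P)$ for some poset $P$.
   Context: A closure operator on $E$ is a function $\tau:2^E\to 2^E$ such that for all $X,Y\subseteq E$: $X\subseteq\tau(X)$; $X\subseteq Y$ implies $\tau(X)\subseteq\tau(Y)$; and $\tau(\tau(X))=\tau(X)$. A set $X\subseteq E$ is closed if $\tau(X)=X$. For $X\in 2^E$, $\mathrm{cov}(X)=\{e\in E\setminus X\mid X\cup\{e\}\in\mathcal{L}\}$. Cover-closure is the map $\xi:\mathcal{L}\to\mathcal{L}$ given by $\xi(X)=\tau(\mathrm{cov}(X))$. An order ideal of a poset $P$ is a subset $I\subseteq P$ such that $y\in I$ and $x\le y$ imply $x\in I$; $J(P)\subseteq 2^P$ is the set of order ideals of $P$. An essentialization of $(\mathcal{L},E)$, for $\mathcal{L}\subseteq 2^E$, is a pair $(\mathcal{L}',E')$ obtained as follows. Every $e\in E'$ must be an element of $E$ such that there exist $X,Y\in\mathcal{L}$ with $e\in X$ and $e\notin Y$. Also, if $Z\subseteq E$, $|Z|>1$, is such that whenever $e\in Z$ and $e\in W\in\mathcal{L}$ we have $Z\subseteq W$, then for any maximal such $Z$ all elements of $Z$ except one are excluded from $E'$. All other elements of $E$ are kept in $E'$. Finally $\mathcal{L}'=\{X\cap E'\mid X\in\mathcal{L}\}$.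 Families $\mathcal{L}_1\subseteq 2^{E_1}$ and $\mathcal{L}_2\subseteq 2^{E_2}$ are isomorphic if there exists a bijection $\varphi:E_1'\to E_2'$ such that $\varphi(\mathcal{L}_1')=\mathcal{L}_2'$.
   Formalization: The ''if'' direction adds the premise that no two distinct elements outside τ(∅) lie in exactly the same closed sets; without it the claim fails, e.g. E={1,2} with closed sets ∅ and E, isomorphic to J(point), where ξ is constant. The ''only if'' direction has no added premise. *)

(* Defs.v *)
From HB Require Import structures.
From mathcomp Require Import all_boot all_order.
From mathcomp Require Import boolp classical_sets functions.

Set Implicit Arguments.
Unset Strict Implicit.
Unset Printing Implicit Defensive.

Import Order.TTheory.
Local Open Scope order_scope.
Local Open Scope classical_set_scope.

Definition closure_operator (E : Type) (tau : set E -> set E) : Prop :=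
  [/\ forall X, X `<=` tau X,
      forall X Y, X `<=` Y -> tau X `<=` tau Y
    & forall X, tau (tau X) = tau X].

Definition closed_sets (E : Type) (tau : set E -> set E) : set (set E) :=
  [set X | tau X = X].

Definition cov (E : Type) (L : set (set E)) (X : set E) : set E :=
  [set e | ~ X e /\ L (X `|` [set e])].

(* Meant to be applied to closed X only; it is then a self-map of
   [closed_sets tau]. *)
Definition cover_closure (E : Type) (tau : set E -> set E) (X : set E) : set E :=
  tau (cov (closed_sets tau) X).

Definition order_ideals (d : Order.disp_t) (P : porderType d) : set (set P) :=
  [set I | forall x y : P, I y -> x <= y -> I x].

Definition nontrivial (E : Type) (L : set (set E)) : set E :=
  [set e | (exists2 X, L X & X e) /\ (exists2 Y, L Y & ~ Y e)].

(* The first clause is |Z| > 1. *)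
Definition inseparable (E : Type) (L : set (set E)) (Z : set E) : Prop :=
  (exists x y, [/\ Z x, Z y & x <> y]) /\
  (forall e W, Z e -> L W -> W e -> Z `<=` W).

Definition max_inseparable (E : Type) (L : set (set E)) : set (set E) :=
  [set Z | inseparable L Z /\
           forall Z', inseparable L Z' -> Z `<=` Z' -> Z' = Z].

(* E' is the ground set of an essentialization of (L, E).  Being the one spared
   element z of a maximal inseparable Z does not exempt z from the requirement
   of nontriviality, whence the intersection in the second clause. *)
Definition essential_ground (E : Type) (L : set (set E)) (E' : set E) : Prop :=
  [/\ E' `<=` nontrivial L,
      forall Z, max_inseparable L Z ->
        exists2 z, Z z & E' `&` Z = [set z] `&` nontrivial L
    & nontrivial L `\` \bigcup_(Z in max_inseparable L) Z `<=` E'].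

(* The family of the X `&` E' for X in L, as a family of subsets of the
   type E'. *)
Definition trace (E : Type) (L : set (set E)) (E' : set E) : set (set E') :=
  [set [set e : E' | X (val e)] | X in L].
Arguments trace {E} L E'.

Definition isomorphic (E1 E2 : Type) (L1 : set (set E1)) (L2 : set (set E2)) :
    Prop :=
  exists (E1' : set E1) (E2' : set E2) (phi : E1' -> E2'),
    [/\ essential_ground L1 E1', essential_ground L2 E2', bijective phi
      & [set phi @` X | X in trace L1 E1'] = trace L2 E2'].

(* Main.v *)
(** Write [K] for the closure of the empty set.

    Cover-closure bijective => order ideals.  If a closed [X] other than [E] had
    no cover, then [X] and [E] would both be sent to [K].  Hence a maximal
    closed set [M] avoiding [e] has a cover, and by maximality [cov M = {e}], so
    [M] is sent to the closure of [e].  By injectivity [M] is therefore the only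
    maximal closed set avoiding [e], and it depends only on the closure of [e].
    The first fact gives [tau A] as the union of [K] and of the closures of the
    points of [A]; the second one says that, outside [K], [f \in tau {e}] is a
    partial order.  The closed sets are the ideals of this order.

    Order ideals => cover-closure bijective.  Under the premise the
    essentialization of [L] only forgets [K], so that the closed sets are the
    ideals of a partial order on [E \ K].  Then [X] is recovered from [cov X],
    which is the set of minimal elements of the complement of [X], and [cov X]
    is recovered from the ideal it generates, as its set of maximal elements;
    an injective self-map of a finite set is surjective. *)

From HB Require Import structures.
Require Import Defs.
From mathcomp Require Import all_boot all_order.
From mathcomp Require Import boolp classical_sets functions.

Set Implicit Arguments.
Unset Strict Implicit.
Unset Printing Implicit Defensive.

Import Order.TTheory.
Local Open Scope order_scope.
Local Open Scope classical_set_scope.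

(** * Extremal members and injective self-maps of finite set families *)

Lemma exists_minimal_set (E : finType) (F : set (set E)) (X : set E) :
  F X -> exists Y, [/\ F Y, Y `<=` X & forall Z, F Z -> Z `<=` Y -> Z = Y].
Proof.
move: {2}_.+1 (ltnSn #|[pred x | `[<X x>]]|) => n.
elim: n X => // n IHn X; rewrite ltnS => cardX FX.
have [minX|] := pselect (forall Z, F Z -> Z `<=` X -> Z = X).
  by exists X; split.
move/existsNP=> [Z /not_implyP[FZ /not_implyP[ZX neqZX]]].
have [|Y [FY YZ minY]] := IHn Z _ FZ; last first.
  by exists Y; split=> //; apply: subset_trans ZX.
apply: leq_trans cardX; apply: proper_card; apply/properP; split.
  by apply/fintype.subsetP => x; rewrite !inE; apply: ZX.
have [x [Xx NZx]] : exists x, X x /\ ~ Z x.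
  apply: contra_notP neqZX => h; apply/seteqP; split=> // x Xx.
  by apply: contrapT => NZx; apply: h; exists x.
by exists x; rewrite !inE; [|apply/asboolPn].
Qed.

Lemma exists_maximal_set (E : finType) (F : set (set E)) (X : set E) :
  F X -> exists Y, [/\ F Y, X `<=` Y & forall Z, F Z -> Y `<=` Z -> Z = Y].
Proof.
move=> FX.
have [|Y [FY YX minY]] :=
  @exists_minimal_set E [set Y | F (~` Y)] (~` X).
  by rewrite /= setCK.
exists (~` Y); split=> // [x Xx /YX /(_ Xx)|Z FZ YZ] //.
rewrite -(minY (~` Z)) ?setCK//= ?setCK// => x NZx.
by apply: contrapT => /YZ /NZx.
Qed.

Lemma set_inj_surj (E : finType) (L : set (set E)) (f : set E -> set E) :
  set_fun L L f -> set_inj L f -> set_surj L L f.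
Proof.
move=> Lf injf Y LY.
pose enc (X : set E) : {set E} := [set x | `[<X x>]]%SET.
pose dec (A : {set E}) : set E := [set x | x \in A].
have encK : cancel enc dec.
  by move=> X; apply/funext => x; rewrite /dec/= inE asboolE.
have decK : cancel dec enc by move=> A; apply/setP => x; rewrite inE asboolb.
(* Extending [f] by the identity outside [L] gives an injection of the whole finite type [{set E}],
   which is onto. *)
pose g A := if `[<L (dec A)>] then enc (f (dec A)) else A.
have injg : injective g.
  move=> A B; rewrite /g.
  case: asboolP => LA; case: asboolP => LB // eqg.
  - by apply/(can_inj decK)/injf; rewrite ?inE//; apply/(can_inj encK).
  - by case: LB; rewrite -eqg encK; apply: Lf.
  - by case: LA; rewrite eqg encK; apply: Lf.
have /codomP[A] := injF_onto injg (enc Y).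
rewrite /g; case: asboolP => [LA /(can_inj encK) YE|NLA AE].
  by exists (dec A).
by case: NLA; rewrite -AE encK.
Qed.

(** * Essentializations with ground set [nontrivial L] *)

Section Essentialization.
Variables (E : Type) (L : set (set E)).

Definition separates_nontrivial :=
  forall x y, nontrivial L x -> nontrivial L y ->
    (forall W, L W -> W x <-> W y) -> x = y.

Lemma inseparable_subset_nontrivial Z x :
  inseparable L Z -> Z x -> nontrivial L x -> Z `<=` nontrivial L.
Proof.
move=> [_ insZ] Zx [[X LX Xx] [Y LY NYx]] y Zy; split.
  by exists X => //; apply: insZ Xx _ Zy.
by exists Y => // Yy; apply: NYx; apply: insZ Yy _ Zx.
Qed.

Lemma inseparable_iff Z x y W :
  inseparable L Z -> Z x -> Z y -> L W -> W x <-> W y.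
Proof.
by move=> [_ insZ] Zx Zy LW; split=> [Wx|Wy];
  [apply: insZ Wx _ Zy|apply: insZ Wy _ Zx].
Qed.

(** Under separation a maximal inseparable [Z] has no nontrivial point, so both sides of the second
    clause are empty. *)
Lemma essential_ground_nontrivial :
  separates_nontrivial -> essential_ground L (nontrivial L).
Proof.
move=> sepL; split=> // Z [insZ _].
have [[x [y [Zx Zy neqxy]]] _] := insZ.
have disjZ w : Z w -> ~ nontrivial L w.
  move=> Zw /(inseparable_subset_nontrivial insZ Zw) ZV; apply: neqxy.
  by apply: sepL; [exact: ZV|exact: ZV|]; move=> W; apply: inseparable_iff insZ Zx Zy.
exists x => //; apply/seteqP; split=> w [].
  by move=> Vw /disjZ.
by move=> -> /(disjZ _ Zx).
Qed.

(** A maximal inseparable [Z] with a nontrivial point would be wholly nontrivial, and the second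
    clause for [nontrivial L] would shrink it to one point. *)
Lemma essential_ground_unique (E' : set E) :
  essential_ground L (nontrivial L) -> essential_ground L E' ->
  E' = nontrivial L.
Proof.
move=> [_ essV _] [E'V _ VE']; apply/seteqP; split=> // x Vx.
apply: VE'; split=> // -[Z maxZ Zx].
have [insZ _] := maxZ; have [[y [z [Zy Zz neqyz]]] _] := insZ.
have ZV := inseparable_subset_nontrivial insZ Zx Vx.
have [w _ VZ] := essV Z maxZ; apply: neqyz.
have Zw u : Z u -> u = w.
  move=> Zu; have : (nontrivial L `&` Z) u by split=> //; apply: ZV.
  by rewrite VZ => -[].
by rewrite (Zw y Zy) (Zw z Zz).
Qed.

End Essentialization.

(** * Families of order ideals are already essential *)

Section OrderIdeals.
Variables (d : Order.disp_t) (P : porderType d).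

Lemma principal_ideal (x : P) : order_ideals [set y | y <= x].
Proof. by move=> y z /= zx yz; apply: le_trans yz zx. Qed.

Lemma nontrivial_order_ideals : nontrivial (@order_ideals d P) = setT.
Proof.
apply/seteqP; split=> // x _; split; first by exists setT.
by exists set0 => // ? ? [].
Qed.

Lemma separates_order_ideals : separates_nontrivial (@order_ideals d P).
Proof.
move=> x y _ _ eqI; apply: le_anti.
have [/(_ (lexx x)) yx _] := eqI _ (@principal_ideal x).
have [_ /(_ (lexx y)) xy] := eqI _ (@principal_ideal y).
by rewrite xy yx.
Qed.

Lemma essential_ground_order_ideals (E' : set P) :
  essential_ground (@order_ideals d P) E' <-> E' = setT.
Proof.
have essV := essential_ground_nontrivial separates_order_ideals.
rewrite -nontrivial_order_ideals; split=> [|->//].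
exact: essential_ground_unique.
Qed.

End OrderIdeals.

(** * Closed sets of a closure operator *)

Section Closure.
Variables (E : finType) (tau : set E -> set E).
Hypothesis htau : closure_operator tau.
Let L := closed_sets tau.
Let xi := cover_closure tau.

Lemma closure_closed X : L (tau X).
Proof. by case: htau => _ _; apply. Qed.

Lemma closure_subset X Y : L Y -> X `<=` Y -> tau X `<=` Y.
Proof. by case: htau => _ mon _ tY XY; rewrite -tY; apply: mon. Qed.

Lemma closure_point X x : L X -> X x -> tau [set x] `<=` X.
Proof. by move=> LX Xx; apply: closure_subset => // _ ->. Qed.

Lemma mem_closure X x : X x -> tau X x.
Proof. by case: htau => ext _ _; apply: ext. Qed.

Lemma closed_setT : L setT.
Proof. by apply/seteqP; split=> // x _; apply: mem_closure. Qed.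

Lemma closedP X : L X <-> tau X `<=` X.
Proof.
split=> [->//|tX]; apply/seteqP; split=> // x; exact: mem_closure.
Qed.

Lemma nontrivialP x : nontrivial L x <-> ~ tau set0 x.
Proof.
split=> [[_ [Y LY NYx]] Kx|NKx]; first by apply: NYx; apply: closure_subset Kx.
split; first by exists setT => //; apply: closed_setT.
by exists (tau set0) => //; apply: closure_closed.
Qed.

Lemma cov_setT : cov L setT = set0.
Proof. by apply/seteqP; split=> // x []; case. Qed.

(** * From injective cover-closure to a partial order *)

Section BijectiveCoverClosure.
Hypothesis inj_xi : set_inj L xi.

Lemma cov_nonempty X : L X -> X <> setT -> exists e, cov L X e.
Proof.
move=> LX XNT; apply: contrapT => cov0; apply: XNT.
apply: inj_xi; rewrite ?inE//; first exact: closed_setT.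
rewrite /xi /cover_closure -/L cov_setT; congr tau.
by apply/seteqP; split=> // e covXe; apply: cov0; exists e.
Qed.

Definition maximal_avoiding (e : E) (M : set E) :=
  [/\ L M, ~ M e & forall X, L X -> ~ X e -> M `<=` X -> X = M].

Lemma cov_maximal_avoiding e M : maximal_avoiding e M -> cov L M = [set e].
Proof.
move=> [LM NMe maxM].
have covM g : cov L M g -> g = e.
  (* If [g <> e], adding [g] to [M] gives a larger closed set still avoiding [e]. *)
  move=> [NMg LMg]; apply: contrapT => neqge; apply: NMg.
  by rewrite -(maxM _ LMg); [right|case=> // eqge; apply: neqge|left].
have [g covMg] : exists g, cov L M g.
  by apply: cov_nonempty => // MT; apply: NMe; rewrite MT.
by apply/seteqP; split=> [h /covM|_ ->]; rewrite -?(covM g).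
Qed.

Lemma maximal_avoiding_inj e f M N : maximal_avoiding e M ->
  maximal_avoiding f N -> tau [set e] = tau [set f] -> M = N.
Proof.
move=> hM hN eqef; have [LM _ _] := hM; have [LN _ _] := hN.
apply: inj_xi; rewrite ?inE//.
rewrite /xi /cover_closure -/L (cov_maximal_avoiding hM).
by rewrite (cov_maximal_avoiding hN).
Qed.

Lemma exists_maximal_avoiding e X : L X -> ~ X e ->
  exists2 M, maximal_avoiding e M & X `<=` M.
Proof.
move=> LX NXe.
have [M [[LM NMe] XM maxM]] :=
  @exists_maximal_set E [set Y | L Y /\ ~ Y e] X (conj LX NXe).
by exists M => //; split=> // Y LY NYe; apply: maxM.
Qed.

(** Both points share one maximal avoiding set, whose only cover is [e] as well as [f]. *)
Lemma closure_antisym e f : ~ tau set0 e -> ~ tau set0 f ->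
  tau [set e] = tau [set f] -> e = f.
Proof.
move=> Ke Kf eqef.
have [M hM _] := exists_maximal_avoiding (closure_closed _) Ke.
have [N hN _] := exists_maximal_avoiding (closure_closed _) Kf.
have := cov_maximal_avoiding hM.
rewrite (maximal_avoiding_inj hM hN eqef) (cov_maximal_avoiding hN) => fe.
by have : [set e] e by []; rewrite -fe.
Qed.

(** Otherwise each [tau [set f]] with [f] in [A] extends to a maximal closed set avoiding [e]; this
    is always the same [M], so [tau A] lies in [M]. *)
Lemma closure_pointwise A e : tau A e -> ~ tau set0 e ->
  exists2 f, A f & tau [set f] e.
Proof.
move=> tAe Ke; apply: contrapT => NA.
have [M hM _] := exists_maximal_avoiding (closure_closed _) Ke.
have [LM NMe _] := hM; apply: NMe.
apply: (closure_subset LM _ tAe) => f Af.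
have Ntfe : ~ tau [set f] e by move=> tfe; apply: NA; exists f.
have [N hN fN] := exists_maximal_avoiding (closure_closed _) Ntfe.
rewrite (maximal_avoiding_inj hM hN erefl); apply: fN; exact: mem_closure.
Qed.

Lemma separates_closed_sets : separates_nontrivial L.
Proof.
move=> e f /nontrivialP Ke /nontrivialP Kf eqW; apply: closure_antisym => //.
apply/seteqP; split; apply: closure_point; try exact: closure_closed.
  by apply/eqW; [exact: closure_closed|exact: mem_closure].
by apply/eqW; [exact: closure_closed|exact: mem_closure].
Qed.

Let V : choiceType := {x : E | x \in nontrivial L}.
Let leV (x y : V) : bool := `[< tau [set val y] (val x) >].

Lemma leV_refl : reflexive leV.
Proof. by move=> x; apply/asboolP; apply: mem_closure. Qed.

Lemma leV_trans : transitive leV.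
Proof.
move=> y x z /asboolP xy /asboolP yz; apply/asboolP.
by apply: closure_point xy => //; apply: closure_closed.
Qed.

Lemma leV_anti : antisymmetric leV.
Proof.
move=> x y /andP[/asboolP xy /asboolP yx]; apply: val_inj => /=.
have NK (z : V) : ~ tau set0 (val z).
  by apply/nontrivialP; have := valP z; rewrite inE.
apply: (closure_antisym (NK x) (NK y)).
by apply/seteqP; split; apply: closure_point => //; apply: closure_closed.
Qed.

Lemma isomorphic_order_ideals :
  exists (d : Order.disp_t) (P : porderType d),
    isomorphic L (@order_ideals d P).
Proof.
pose d := Order.Disp tt tt; exists d.
pose Vle := Order.Le_isPOrder.Build d V leV_refl leV_anti leV_trans.
pose P : porderType d := HB.pack V Vle.
have leP (x y : P) : (x <= y) = leV x y by [].
exists P, (nontrivial L), setT, (fun x : V => exist _ (x : P) (mem_set I)).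
split.
- exact/essential_ground_nontrivial/separates_closed_sets.
- exact/essential_ground_order_ideals.
- exists (fun x => val x) => [x //|[x Tx]].
  by apply: val_inj.
- apply/seteqP; split.
  + move=> _ [_ [X LX <-] <-].
    exists [set x : P | X (val (x : V))].
      move=> x y /= Xy; rewrite leP => /asboolP; exact: closure_point.
    apply/seteqP; split=> [y /= Xy|_ [y /= Xy <-] //=].
    by exists (val y) => //; apply: val_inj.
  + move=> _ [I idI <-].
    (* [X] is [I] together with [tau set0], whose points satisfy the condition vacuously. *)
    pose X : set E := [set e | forall x : V, val x = e -> I x].
    have LX : L X.
      apply/closedP => e tXe x xe.
      have Vx : nontrivial L e by rewrite -xe; have := valP x; rewrite inE.
      have [f Xf tfe] := closure_pointwise tXe (proj1 (nontrivialP e) Vx).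
      have [Kf|Kf] := pselect (tau set0 f).
        exfalso; apply: (proj1 (nontrivialP e) Vx).
        by apply: (closure_point _ Kf tfe); apply: closure_closed.
      have Vf : f \in nontrivial L by rewrite inE; apply/nontrivialP.
      apply: (idI x (exist _ f Vf : V)); first exact: Xf.
      by rewrite leP; apply/asboolP; rewrite xe.
    exists [set x : V | I x].
      exists X => //; apply/seteqP; split=> x /=; first exact.
      by move=> Ix y /val_inj ->.
    apply/seteqP; split=> [_ [y /= Iy <-] //=|y /= Iy].
    by exists (val y) => //; apply: val_inj.
Qed.

End BijectiveCoverClosure.

(** * Bijectivity from a pointwise and antisymmetric closure *)

Section PointwiseClosure.
Hypothesis tau_pointwise : forall A e, tau A e -> ~ tau set0 e ->
  exists2 f, A f & tau [set f] e.
Hypothesis tau_antisym : forall e f, ~ tau set0 e -> ~ tau set0 f ->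
  tau [set f] e -> tau [set e] f -> e = f.

Lemma closed_notin_bot X e : L X -> ~ X e -> ~ tau set0 e.
Proof. by move=> LX NXe Ke; apply: NXe; apply: closure_subset Ke. Qed.

(** Among the points of [tau [set f]] outside [X], one whose closure is minimal can be added to
    [X]. *)
Lemma exists_cov_le X f : L X -> ~ X f -> exists2 e, cov L X e & tau [set f] e.
Proof.
move=> LX NXf.
have [Y [[e eY [NXe tfe]] _ minY]] := @exists_minimal_set E
  [set Y | exists2 e, Y = tau [set e] & ~ X e /\ tau [set f] e] (tau [set f])
  (ex_intro2 _ _ f erefl (conj NXf (mem_closure (erefl f)))).
exists e => //; split=> //; apply/closedP => g tg.
apply: contrapT => Ng.
have NXg : ~ X g by move=> Xg; apply: Ng; left.
have NKg := closed_notin_bot LX NXg.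
have [h [Xh|->] thg] := tau_pointwise tg NKg.
  by apply: NXg; apply: closure_point thg.
apply: Ng; right; apply: tau_antisym => //; first exact: closed_notin_bot NXe.
(* [g] also competes for minimality, so its closure cannot be strictly smaller. *)
rewrite (_ : tau [set g] = tau [set e]); first exact: mem_closure.
have tge : tau [set g] `<=` tau [set e].
  by apply: closure_point => //; apply: closure_closed.
rewrite -eY; apply: minY; last by rewrite eY.
exists g => //; split=> //.
by apply: closure_point tfe _ thg; apply: closure_closed.
Qed.

Lemma closed_cov X : L X ->
  X = [set f | forall e, cov L X e -> ~ tau [set f] e].
Proof.
move=> LX; apply/seteqP; split=> f /=.
  by move=> Xf e [NXe _] tfe; apply: NXe; apply: closure_point tfe.
move=> hf; apply: contrapT => /(exists_cov_le LX)[e covXe].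
exact: hf.
Qed.

Lemma cov_notin_bot X e : L X -> cov L X e -> ~ tau set0 e.
Proof. by move=> LX [NXe _]; apply: closed_notin_bot NXe. Qed.

Lemma cov_antichain X e f : L X -> cov L X e -> cov L X f ->
  tau [set f] e -> e = f.
Proof.
move=> LX [NXe _] [_ LXf] tfe.
by have [] := closure_point LXf (or_intror erefl) tfe.
Qed.

(** A cover [e] of [X] lies below a cover [f] of [X'], itself below a cover [g] of [X]; the
    antichain property gives [e = g], and antisymmetry then gives [e = f]. *)
Lemma cov_subset_of_closure X X' : L X -> L X' -> xi X = xi X' ->
  cov L X `<=` cov L X'.
Proof.
move=> LX LX' eqxi e cXe.
have NKe := cov_notin_bot LX cXe.
have : xi X e by apply: mem_closure.
rewrite eqxi => /tau_pointwise/(_ NKe)[f cX'f tfe].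
have NKf := cov_notin_bot LX' cX'f.
have : xi X' f by apply: mem_closure.
rewrite -eqxi => /tau_pointwise/(_ NKf)[g cXg tgf].
have eg : e = g.
  apply: cov_antichain cXe cXg _ => //.
  by apply: closure_point tgf _ tfe; apply: closure_closed.
by rewrite (tau_antisym NKe NKf tfe) // eg.
Qed.

Lemma cover_closure_bij : set_bij L L xi.
Proof.
have Lxi : set_fun L L xi by move=> X _; apply: closure_closed.
have inj_xi : set_inj L xi.
  move=> X X'; rewrite !inE => LX LX' eqxi.
  rewrite (closed_cov LX) (closed_cov LX').
  suff -> : cov L X = cov L X' by [].
  by apply/seteqP; split; apply: cov_subset_of_closure.
by split=> //; apply: set_inj_surj.
Qed.

End PointwiseClosure.

(** * Transport of the order along an isomorphism with ideals *)

Section FromIdeals.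
Variables (d : Order.disp_t) (P : porderType d).
Variable phi : nontrivial L -> [set: P].
Hypothesis phi_bij : bijective phi.
Hypothesis phi_trace :
  [set phi @` X | X in trace L (nontrivial L)] = trace (@order_ideals d P) setT.
Let p (x : nontrivial L) : P := val (phi x).

Lemma closed_le_stable X x y : L X -> X (val y) -> p x <= p y -> X (val x).
Proof.
move=> LX Xy xy.
have : [set phi @` X | X in trace L (nontrivial L)]
    (phi @` [set z | X (val z)]) by exists [set z | X (val z)] => //; exists X.
rewrite phi_trace => -[I idI eqI].
have : [set q : [set: P] | I (val q)] (phi x).
  apply: (idI _ (p y)) => //.
  suff : [set q : [set: P] | I (val q)] (phi y) by [].
  by rewrite eqI; exists y.
by rewrite eqI => -[z Xz /(bij_inj phi_bij) <-].
Qed.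

Lemma exists_closed_of_ideal I : @order_ideals d P I ->
  exists2 X, L X & forall x, X (val x) <-> I (p x).
Proof.
move=> idI.
have : trace (@order_ideals d P) setT [set q : [set: P] | I (val q)].
  by exists I.
rewrite -phi_trace => -[_ [X LX <-]] eqI; exists X => // x.
have -> : I (p x) = [set q : [set: P] | I (val q)] (phi x) by [].
by rewrite -eqI; split=> [Xx|[y Xy /(bij_inj phi_bij) <-] //]; exists x.
Qed.

(** Closed sets trace to ideals, which gives one direction; the closed set realizing the principal
    ideal of [p y] gives the other. *)
Lemma closure_leP x y : p x <= p y <-> tau [set val y] (val x).
Proof.
split=> [|txy]; first by apply: closed_le_stable;
  [exact: closure_closed|exact: mem_closure].
have [X LX XP] := exists_closed_of_ideal (@principal_ideal d P (p y)).
by apply/(XP x); apply: closure_point txy => //; apply/XP => /=.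
Qed.

Lemma nontrivial_val e : ~ tau set0 e -> exists x : nontrivial L, val x = e.
Proof.
move=> /nontrivialP/mem_set Ve; by exists (exist _ e Ve).
Qed.

Lemma cover_closure_bij_of_ideals : set_bij L L xi.
Proof.
apply: cover_closure_bij => [A e tAe NKe|e f].
  have [x xe] := nontrivial_val NKe; subst e.
  (* The closed set realizing the ideal generated by the image of [A] contains [A], hence
     [tau A]. *)
  pose I := [set q : P | exists2 y, A (val y) & q <= p y].
  have idI : order_ideals I.
    by move=> q r [y Ay ry] qr; exists y => //; apply: le_trans ry.
  have [X LX XP] := exists_closed_of_ideal idI.
  have /XP[y Ay xy] : X (val x).
    apply: closure_subset tAe => // a Aa.
    have [Ka|NKa] := pselect (tau set0 a); first exact: closure_subset Ka.
    have [y ya] := nontrivial_val NKa; subst a.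
    by apply/XP; exists y.
  by exists (val y) => //; apply/closure_leP.
move=> /nontrivial_val[x <-] /nontrivial_val[y <-].
move=> /closure_leP xy /closure_leP yx; congr val.
by apply/(bij_inj phi_bij)/val_inj/le_anti/andP.
Qed.

End FromIdeals.

End Closure.

Theorem theorem4p8 (E : finType) (tau : set E -> set E)
    (htau : closure_operator tau) :
  let L := closed_sets tau in
  let xi_bijective := set_bij L L (cover_closure tau) in
  let L_iso_ideals :=
    exists (d : Order.disp_t) (P : porderType d),
      isomorphic L (@order_ideals d P) in
  (xi_bijective -> L_iso_ideals) /\
  (* The premise says that passing to the essentialization discards only
     elements lying in every or in no closed set.  Without it the implication
     fails: for E = {1, 2} and closed sets {}, E (isomorphic to J(point)),
     cover-closure is constant. *)
  (essential_ground L (nontrivial L) -> L_iso_ideals -> xi_bijective).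
Proof.
move=> L xi_bijective L_iso_ideals; split=> [[_ inj_xi _]|essV].
  exact: isomorphic_order_ideals.
move=> [d [P [E1 [E2 [phi [ess1 ess2 phi_bij phi_trace]]]]]].
(* Both ground sets are forced, so [phi] maps [nontrivial L] onto all of [P]. *)
have E1E := essential_ground_unique essV ess1; subst E1.
have /essential_ground_order_ideals E2E := ess2; subst E2.
exact: cover_closure_bij_of_ideals phi_bij phi_trace.
Qed.
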